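(* Throw $m$ balls independently into $n$ bins, where each ball lands in bin $i$ with probability $p_i$ ($\sum_{i=1}^n p_i=1$), and let $L$ be the maximum number of balls in a single bin. If $m\in\Omega(n/\mathrm{polylog}\,n)$, then $L\in\Omega\left(\frac{\log n}{\log\log n}\right)$ asymptotically almost surely.
   Context: ''Asymptotically almost surely'' means with probability tending to $1$ as $n\to\infty$; $\mathrm{polylog}\,n$ denotes $(\log n)^{O(1)}$. *)

(* Defs.v *)
From HB Require Import structures.
From mathcomp Require Import all_boot all_order all_algebra.
From mathcomp Require Import all_classical all_reals all_analysis.
Set Implicit Arguments. Unset Strict Implicit. Unset Printing Implicit Defensive.
Import Order.TTheory GRing.Theory Num.Theory.
Local Open Scope ring_scope.

(* An outcome of throwing m balls into n bins: ball j lands in bin (f j). *)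
Definition load (m n : nat) (f : {ffun 'I_m -> 'I_n}) (i : 'I_n) : nat :=
  #|[set j | f j == i]|.

Definition maxload (m n : nat) (f : {ffun 'I_m -> 'I_n}) : nat :=
  (\max_(i : 'I_n) load f i)%N.

Definition prob_vec (R : realType) (n : nat) (p : 'I_n -> R) : Prop :=
  (forall i, 0 <= p i) /\ \sum_(i < n) p i = 1.

(* Probability of an event E on outcomes, balls thrown independently
   with distribution p: P(f) = prod_j p (f j). *)
Definition Pr_balls (R : realType) (m n : nat) (p : 'I_n -> R)
  (E : pred {ffun 'I_m -> 'I_n}) : R :=
  \sum_(f : {ffun 'I_m -> 'I_n} | E f) \prod_(j < m) p (f j).

(* Main.v *)
Require Import Defs.
From HB Require Import structures.
From mathcomp Require Import all_boot all_order all_algebra.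
From mathcomp Require Import all_classical all_reals all_analysis.
From mathcomp Require Import ring lra.
Set Implicit Arguments. Unset Strict Implicit. Unset Printing Implicit Defensive.
Import Order.TTheory GRing.Theory Num.Theory.
Import numFieldNormedType.Exports.
Local Open Scope classical_set_scope.
Local Open Scope ring_scope.

(** Grouping the outcomes by their loads, P(all loads < k) is m! times the
coefficient of X^m in the product over the bins i of T_k(p_i X), where T_k is
the exponential series truncated to its first k terms.  As the coefficients are
nonnegative, evaluating at X = m gives
  P(max load < k) <= (m! e^m / m^m) * prod_i P(Poisson(m p_i) < k),
and m! e^m / m^m <= e m.  If m >= n k, then the pigeonhole principle suffices.
Otherwise m <= n^2, so it is enough to bound the product by n^-3.  Let L = ln n.
If some m p_i exceeds 8 L, then a Chernoff bound on the i-th factor does it.  If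
not, at least (m - n mu) / (8 L) bins have mean at least mu = c / (2 L^C); each
of them contributes a factor at most 1 - e^-mu mu^k / k!, and for k about
L / (2 (C + 2) ln L) the quantity mu^k / k! is at least n^(-1/2) up to powers
of L. *)

(** * Loads and the generating function of the capped loads *)

Lemma deriv_prod_seq (R : comNzRingType) (I : eqType) (r : seq I)
    (F : I -> {poly R}) : uniq r ->
  (\prod_(i <- r) F i)^`() =
  \sum_(i <- r) \prod_(j <- r) (if j == i then (F j)^`() else F j).
Proof.
elim: r => [|x r IHr] /=; first by rewrite !big_nil -[1]/(1%:P) derivC.
move=> /andP[xr ur]; rewrite !big_cons derivM eqxx IHr //; congr (_ * _ + _).
  by apply: eq_big_seq => j jr; case: eqP => // ej; rewrite -ej jr in xr.
rewrite mulr_sumr; apply: eq_big_seq => i ir; rewrite big_cons.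
by case: eqP => // ei; rewrite ei ir in xr.
Qed.

(** Separates the first ball from the others, for the induction on the number of balls in
    [sum_capped_loads]. *)
Lemma sum_ffun_recl (R : pzSemiRingType) (I : finType) (m : nat)
    (F : {ffun 'I_m.+1 -> I} -> R) :
  \sum_f F f =
  \sum_i \sum_(g : {ffun 'I_m -> I})
    F [ffun j => if unlift ord0 j is Some j' then g j' else i].
Proof.
rewrite pair_big /=.
rewrite (reindex (fun u : I * {ffun 'I_m -> I} =>
  [ffun j => if unlift ord0 j is Some j' then u.2 j' else u.1])) //=.
exists (fun f => (f ord0, [ffun j => f (lift ord0 j)])) => [[i g] _|f _] /=.
  rewrite ffunE unlift_none; congr pair; apply/ffunP => j.
  by rewrite !ffunE liftK.
by apply/ffunP => j; rewrite !ffunE /=; case: unliftP => [j'|] -> //; rewrite ffunE.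
Qed.

Lemma loadE (m n : nat) (f : {ffun 'I_m -> 'I_n}) (i : 'I_n) :
  load f i = (\sum_(j < m) (f j == i))%N.
Proof.
by rewrite /load -sum1_card big_mkcond; apply: eq_bigr => j _; rewrite inE; case: eqP.
Qed.

Lemma sum_load (m n : nat) (f : {ffun 'I_m -> 'I_n}) :
  (\sum_(i < n) load f i = m)%N.
Proof.
under eq_bigr do rewrite loadE.
rewrite exchange_big /= -[RHS](card_ord m) -sum1_card; apply: eq_bigr => j _.
rewrite (bigD1 (f j)) //= eqxx big1 // => i.
by rewrite eq_sym => /negbTE ->.
Qed.

Lemma leq_balls_maxload (m n : nat) (f : {ffun 'I_m -> 'I_n}) :
  (m <= n * maxload f)%N.
Proof.
rewrite -[X in (X <= _)%N](sum_load f).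
apply: (@leq_trans (\sum_(i < n) maxload f)); last by rewrite sum_nat_const card_ord.
by apply: leq_sum => i _; rewrite /maxload (leq_bigmax i).
Qed.

Lemma maxload_lt (m n k : nat) (f : {ffun 'I_m -> 'I_n}) : (0 < k)%N ->
  (maxload f < k)%N = [forall i, (load f i < k)%N].
Proof.
case: k => // k _; rewrite ltnS; apply/bigmax_leqP/forallP => [H i|H i _].
  by rewrite ltnS H.
by rewrite -ltnS H.
Qed.

Section CappedLoads.
Variable R : realType.

Definition texp_poly (k : nat) (y : R) : {poly R} :=
  \poly_(j < k) (y ^+ j / j`!%:R).

Lemma deriv_texp_poly k y : (texp_poly k y)^`() = y *: texp_poly k.-1 y.
Proof.
apply/polyP => j; rewrite coef_deriv coefZ !coef_poly.
case: k => [|k] /=; first by rewrite mul0rn mulr0.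
rewrite ltnS; case: ltnP => _; last by rewrite mul0rn mulr0.
have j1 : j.+1%:R != 0 :> R by rewrite pnatr_eq0.
have jf : j`!%:R != 0 :> R by rewrite pnatr_eq0 -lt0n fact_gt0.
rewrite -[LHS]mulr_natr factS natrM exprS invfM -!mulrA; congr (_ * (_ * _)).
by rewrite mulrCA mulVf ?mulr1.
Qed.

(** The cap may vary with the bin because the induction on the balls lowers one cap at a time. *)
Definition capped_poly (n : nat) (y : 'I_n -> R) (kappa : 'I_n -> nat) : {poly R} :=
  \prod_(i < n) texp_poly (kappa i) (y i).

Lemma deriv_capped_poly n (y : 'I_n -> R) kappa :
  (capped_poly y kappa)^`() =
  \sum_(i < n) y i *: capped_poly y (fun l => kappa l - (l == i))%N.
Proof.
rewrite /capped_poly deriv_prod_seq ?index_enum_uniq //; apply: eq_bigr => i _.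
rewrite (bigD1 i) //= [in RHS](bigD1 i) //= !eqxx subn1 deriv_texp_poly scalerAl.
by congr (_ * _); apply: eq_bigr => l /negbTE ->; rewrite subn0.
Qed.

(* Throwing the first ball into bin i lowers the cap of bin i by one, which is
   also what differentiating the i-th factor of the product does. *)
Lemma sum_capped_loads n m (y : 'I_n -> R) kappa :
  \sum_(f : {ffun 'I_m -> 'I_n} | [forall i, (load f i < kappa i)%N])
     \prod_(j < m) y (f j) = m`!%:R * (capped_poly y kappa)`_m.
Proof.
elim: m kappa => [|m IHm] kappa.
  rewrite fact0 mul1r -horner_coef0 /capped_poly horner_prod.
  rewrite (eq_bigr (fun i => (0 < kappa i)%N%:R)); last first.
    move=> i _; rewrite horner_coef0 coef_poly; case: ltnP => //= _.
    by rewrite expr0 fact0 divr1.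
  under [LHS]eq_bigr do rewrite big_ord0.
  rewrite (eq_bigl (fun=> [forall i, (0 < kappa i)%N])); last first.
    by move=> f; apply: eq_forallb => i; rewrite loadE big_ord0.
  have [/forallP H|] := boolP [forall i, (0 < kappa i)%N].
    rewrite sumr_const card_ffun !card_ord [RHS]big1 // => i _; first by rewrite H.
  rewrite negb_forall => /existsP[i /negbTE Hi].
  by rewrite big_pred0_eq (bigD1 i) //= Hi mul0r.
have -> : m.+1`!%:R * (capped_poly y kappa)`_m.+1 =
          m`!%:R * ((capped_poly y kappa)^`())`_m.
  by rewrite coef_deriv factS natrM -[X in _ = _ * X]mulr_natl mulrA [_ * m.+1%:R]mulrC.
rewrite deriv_capped_poly coef_sum mulr_sumr big_mkcond sum_ffun_recl /=.
apply: eq_bigr => i _; rewrite coefZ mulrCA -IHm mulr_sumr [RHS]big_mkcond /=.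
apply: eq_bigr => g _; rewrite big_ord_recl ffunE unlift_none.
under [\prod_(j < m) _]eq_bigr do rewrite ffunE liftK.
(* The first ball adds [l == i] to the load of bin [l]. Truncated subtraction is harmless: at cap 0
   both conditions fail. *)
congr (if _ then _ else _); apply: eq_forallb => l.
rewrite ltn_subRL !loadE big_ord_recl ffunE unlift_none eq_sym.
by under eq_bigr do rewrite ffunE liftK.
Qed.

Lemma horner_capped_poly n (y : 'I_n -> R) kappa x :
  (capped_poly y kappa).[x] =
  \prod_(i < n) \sum_(j < kappa i) (x * y i) ^+ j / j`!%:R.
Proof.
rewrite horner_prod; apply: eq_bigr => i _; rewrite horner_poly.
by apply: eq_bigr => j _; rewrite exprMn mulrAC [x ^+ _ * _]mulrC.
Qed.

Lemma capped_poly_coef_ge0 n (y : 'I_n -> R) kappa : (forall i, 0 <= y i) ->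
  forall m, 0 <= (capped_poly y kappa)`_m.
Proof.
move=> y0; rewrite /capped_poly; elim/big_rec: _ => [|i q _ IHq] m.
  by rewrite coef1 ler0n.
rewrite coefM sumr_ge0 // => j _; rewrite mulr_ge0 // coef_poly.
by case: ifP => // _; rewrite divr_ge0 ?exprn_ge0.
Qed.

Lemma coef_mul_exp_le_horner (q : {poly R}) x m : 0 <= x ->
  (forall j, 0 <= q`_j) -> q`_m * x ^+ m <= q.[x].
Proof.
(* The sum is padded beyond the size of [q] so that the term of index [m] always occurs in it. *)
move=> x0 q0; rewrite (horner_coef_wide x (leq_maxl (size q) m.+1)).
have mlt : (m < maxn (size q) m.+1)%N by rewrite leq_maxr.
rewrite (bigD1 (Ordinal mlt)) //= lerDl sumr_ge0 // => j _.
by rewrite mulr_ge0 ?exprn_ge0.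
Qed.

End CappedLoads.

(** * Lower tails of Poisson variables *)

Section PoissonTail.
Variable R : realType.
Implicit Types (k n : nat) (x y mu : R).

Definition texp k x : R := \sum_(j < k) x ^+ j / j`!%:R.

Lemma texp_term_ge0 j x : 0 <= x -> 0 <= x ^+ j / j`!%:R.
Proof. by move=> x0; rewrite divr_ge0 ?exprn_ge0. Qed.

Lemma texp_ge0 k x : 0 <= x -> 0 <= texp k x.
Proof. by move=> x0; rewrite sumr_ge0 // => j _; rewrite texp_term_ge0. Qed.

Lemma texp_le_expR k x : 0 <= x -> texp k x <= expR x.
Proof.
move=> x0.
have -> : texp k x = series (exp_coeff x) k by rewrite /series /= big_mkord.
apply: nondecreasing_cvgn_le; last exact: is_cvg_series_exp_coeff.
by apply: nondecreasing_series => j _ _; exact: exp_coeff_ge0.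
Qed.

(** Termwise, [x ^+ j = 2 ^+ j * (x / 2) ^+ j] with [j < k]; what remains is a partial sum of the
    series for [expR (x / 2)]. *)
Lemma texp_half k x : 0 <= x -> texp k x <= 2 ^+ k * expR (x / 2).
Proof.
move=> x0; have x20 : 0 <= x / 2 by rewrite divr_ge0.
apply: (@le_trans _ _ (2 ^+ k * texp k (x / 2))); last first.
  by rewrite ler_wpM2l ?exprn_ge0 // texp_le_expR.
rewrite mulr_sumr; apply: ler_sum => j _.
rewrite mulrA ler_wpM2r ?invr_ge0 //.
rewrite -{1}[x](@mulfVK _ 2) ?pnatr_eq0 // exprMn mulrC ler_wpM2r ?exprn_ge0 //.
by rewrite ler_weXn2l ?ler1n // ltnW.
Qed.

(** The binomial formula turns the left side into a double sum over [i <= j < k]; for fixed [i] the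
    powers of [y] form a partial sum of [expR y]. *)
Lemma texpD_le k x y : 0 <= x -> 0 <= y -> texp k (x + y) <= texp k x * expR y.
Proof.
move=> x0 y0.
pose u j z : R := z ^+ j / j`!%:R.
have binom (j : 'I_k) : u j (x + y) =
    \sum_(i < k | (i <= j)%N) u i x * u (j - i)%N y.
  rewrite /u addrC exprDn mulr_suml.
  rewrite (big_ord_widen k (fun i => y ^+ (j - i) * x ^+ i *+ 'C(j, i) / j`!%:R)) //.
  apply: eq_bigr => i; rewrite ltnS => ij.
  have fn0 l : l`!%:R != 0 :> R by rewrite pnatr_eq0 -lt0n fact_gt0.
  rewrite mulrACA -invfM [_ ^+ i * _]mulrC -mulr_natr -mulrA; congr (_ * _).
  apply: (mulIf (fn0 j)); rewrite mulfVK //.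
  by rewrite -(bin_fact ij) !natrM mulrCA mulVf ?mulr1 // mulf_neq0.
rewrite /texp (eq_bigr _ (fun j _ => binom j)).
rewrite (exchange_big_dep predT) //= mulr_suml.
apply: ler_sum => i _; rewrite -mulr_sumr ler_wpM2l ?texp_term_ge0 //.
rewrite -(big_geq_mkord _ _ xpredT (fun j => u (j - i)%N y)).
rewrite -{1}[nat_of_ord i]add0n big_addn big_mkord.
under eq_bigr do rewrite addnK.
exact: texp_le_expR.
Qed.

(* The probability that a Poisson variable of mean x is less than k. *)
Definition poisson_lt k x : R := expR (- x) * texp k x.

Lemma poisson_lt_ge0 k x : 0 <= x -> 0 <= poisson_lt k x.
Proof. by move=> x0; rewrite mulr_ge0 ?expR_ge0 ?texp_ge0. Qed.

Lemma poisson_lt_le1 k x : 0 <= x -> poisson_lt k x <= 1.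
Proof.
move=> x0; rewrite /poisson_lt -[leRHS](expRxMexpNx_1 x) [leRHS]mulrC.
by rewrite ler_wpM2l ?expR_ge0 // texp_le_expR.
Qed.

(** A Poisson variable of mean [y] is one of mean [x] plus an independent one of mean [y - x];
    [texpD_le] is the analytic form of this. *)
Lemma poisson_lt_anti k x y : 0 <= x -> x <= y ->
  poisson_lt k y <= poisson_lt k x.
Proof.
move=> x0 xy; rewrite /poisson_lt -{2}[y](subrKC x).
apply: (le_trans (ler_wpM2l (expR_ge0 _) (texpD_le k x0 _))); first by rewrite subr_ge0.
by rewrite mulrCA -expRD addKr mulrC.
Qed.

Lemma poisson_lt_chernoff k x : 0 <= x ->
  poisson_lt k x <= 2 ^+ k * expR (- (x / 2)).
Proof.
move=> x0; apply: (le_trans (ler_wpM2l (expR_ge0 _) (texp_half k x0))).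
rewrite mulrCA -expRD; apply: ler_wpM2l; first exact: exprn_ge0.
by rewrite ler_expR; lra.
Qed.

(** A value below [k] excludes the value [k], and [1 - u <= expR (- u)] for the probability [u] of
    the latter. *)
Lemma poisson_lt_le_expR k mu : 0 <= mu ->
  poisson_lt k mu <= expR (- (expR (- mu) * (mu ^+ k / k`!%:R))).
Proof.
move=> mu0; apply: (le_trans _ (expR_ge1Dx _)).
rewrite -[X in X + _](expRxMexpNx_1 mu) [_ * expR (- mu)]mulrC -mulrBr.
rewrite ler_wpM2l ?expR_ge0 // lerBrDr.
by apply: (le_trans _ (texp_le_expR k.+1 mu0)); rewrite /texp big_ord_recr.
Qed.

(* Either one factor alone is tiny, or every mean is at most 8L, and then the
   number of means above mu is at least (sum - n mu) / (8L). *)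
Lemma prod_poisson_lt k n (lam : 'I_n -> R) (L mu : R) :
  0 < L -> 0 <= mu -> (forall i, 0 <= lam i) ->
  \prod_(i < n) poisson_lt k (lam i) <= 2 ^+ k * expR (- (4 * L)) \/
  \prod_(i < n) poisson_lt k (lam i) <=
    expR (- (expR (- mu) * (mu ^+ k / k`!%:R) *
             ((\sum_(i < n) lam i - n%:R * mu) / (8 * L)))).
Proof.
move=> L0 mu0 lam0.
have [/existsP[i Hi]|] := boolP [exists i, 8 * L < lam i].
  left; rewrite (bigD1 i) //=.
  have P1 : \prod_(j < n | j != i) poisson_lt k (lam j) <= 1.
    by apply: prodr_ile1 => j _; rewrite poisson_lt_ge0 ?poisson_lt_le1.
  apply: (le_trans (ler_wpM2l (poisson_lt_ge0 k (lam0 i)) P1)); rewrite mulr1.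
  apply: (le_trans (poisson_lt_chernoff k (lam0 i))).
  by rewrite ler_wpM2l ?exprn_ge0 // ler_expR; lra.
rewrite negb_exists => /forallP H; right.
set eps := expR (- mu) * _.
have eps0 : 0 <= eps by rewrite mulr_ge0 ?expR_ge0 ?texp_term_ge0.
(* The exponent is spread over the bins. A mean below [mu] receives a nonnegative exponent; a mean
   in [[mu, 8 * L]] receives at least [- eps]. *)
have -> : - (eps * ((\sum_(i < n) lam i - n%:R * mu) / (8 * L))) =
    \sum_(i < n) - (eps * ((lam i - mu) / (8 * L))).
  rewrite sumrN -mulr_sumr -mulr_suml big_split /= sumr_const card_ord.
  by rewrite mulNrn mulr_natl.
rewrite expR_sum; apply: ler_prod => i _; rewrite poisson_lt_ge0 //=.
have L8 : 0 < 8 * L by rewrite mulr_gt0.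
have [lm|lm] := ltP (lam i) mu.
  apply: (le_trans (poisson_lt_le1 k (lam0 i))); rewrite -[leLHS]expR0 ler_expR.
  rewrite oppr_ge0; apply: mulr_ge0_le0 => //.
  by rewrite ler_pdivrMr // mul0r subr_le0 ltW.
apply: (le_trans (poisson_lt_anti k mu0 lm)).
apply: (le_trans (poisson_lt_le_expR k mu0)); rewrite ler_expR lerN2.
rewrite -[leRHS]mulr1 ler_wpM2l // ler_pdivrMr // mul1r.
by move: (H i); rewrite -leNgt => Hi; lra.
Qed.

End PoissonTail.

(** * Poissonization *)

Section Poissonization.
Variable R : realType.

(** A weak Stirling bound, by induction; the step amounts to [e <= (1 + 1/M)^(M+1)]. *)
Lemma fact_mul_expR_le m : (0 < m)%N ->
  m`!%:R * expR m%:R <= expR 1 * m%:R * m%:R ^+ m :> R.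
Proof.
elim: m => // -[|m] IHm _; first by rewrite expr1n !mulr1 mul1r.
have {}IHm := IHm isT; set M := m.+1%:R : R in IHm *.
have -> : m.+2%:R = M + 1 :> R by rewrite /M -natr1.
have M0 : 0 < M by rewrite ltr0n.
have M10 : 0 < M + 1 by rewrite addr_gt0.
(* [1 - 1/(M+1) <= exp (-1/(M+1))] raised to the power [M+1] *)
have key : M ^+ m.+2 * expR 1 <= (M + 1) ^+ m.+2.
  have h : M * expR ((M + 1)^-1) <= M + 1.
    have := ler_wpM2r (expR_ge0 (M + 1)^-1) (expR_ge1Dx (- (M + 1)^-1)).
    rewrite [leRHS]mulrC expRxMexpNx_1 -(ler_pM2l M10) mulr1 mulrA mulrBr.
    by rewrite mulr1 mulfV ?gt_eqF // addrK.
  have := lerXn2r m.+2 _ _ h; rewrite !nnegrE exprMn -expRM_natr.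
  have -> : (M + 1)^-1 * m.+2%:R = 1 by rewrite /M natr1 mulVf // pnatr_eq0.
  by apply; rewrite ?mulr_ge0 ?expR_ge0 // ltW.
rewrite factS natrM expRD -natr1 -/M.
have -> : (M + 1) * m.+1`!%:R * (expR M * expR 1) =
          (M + 1) * expR 1 * (m.+1`!%:R * expR M) by ring.
have -> : expR 1 * (M + 1) * (M + 1) ^+ m.+2 =
          (M + 1) * expR 1 * (M + 1) ^+ m.+2 by ring.
rewrite ler_wpM2l ?mulr_ge0 ?expR_ge0 ?(ltW M10) //.
apply: (le_trans IHm); apply: le_trans key.
by rewrite -mulrA -exprS mulrC.
Qed.

Lemma Pr_ballsT m n (p : 'I_n -> R) : prob_vec p ->
  Pr_balls p (fun f : {ffun 'I_m -> 'I_n} => true) = 1.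
Proof.
case=> _ p1; rewrite /Pr_balls -(bigA_distr_bigA (fun (_ : 'I_m) i => p i)).
by rewrite big1 // => j _; rewrite p1.
Qed.

Lemma Pr_balls_ge0 m n (p : 'I_n -> R) (E : pred {ffun 'I_m -> 'I_n}) :
  prob_vec p -> 0 <= Pr_balls p E.
Proof. by case=> p0 _; rewrite sumr_ge0 // => f _; rewrite prodr_ge0. Qed.

Lemma le_Pr_balls m n (p : 'I_n -> R) (E F : pred {ffun 'I_m -> 'I_n}) :
  prob_vec p -> {subset E <= F} -> Pr_balls p E <= Pr_balls p F.
Proof.
case=> p0 _ EF; rewrite /Pr_balls [leLHS]big_mkcond [leRHS]big_mkcond.
apply: ler_sum => f _; have w0 : 0 <= \prod_(j < m) p (f j) by rewrite prodr_ge0.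
by have := EF f; rewrite !unfold_in; case: (E f); case: (F f) => // /(_ isT).
Qed.

Lemma Pr_ballsC m n (p : 'I_n -> R) (E : pred {ffun 'I_m -> 'I_n}) :
  prob_vec p -> Pr_balls p E = 1 - Pr_balls p (predC E).
Proof.
move=> /(Pr_ballsT m) <-; rewrite /Pr_balls [X in _ = X - _](bigID E) /= addrK.
by apply: eq_bigl => f.
Qed.

Lemma Pr_maxload_lt m n k (p : 'I_n -> R) : prob_vec p -> (0 < m)%N -> (0 < k)%N ->
  Pr_balls p (fun f : {ffun 'I_m -> 'I_n} => (maxload f < k)%N) <=
  expR 1 * m%:R * \prod_(i < n) poisson_lt k (m%:R * p i).
Proof.
move=> [p0 p1] m0 k0; have M0 : 0 < m%:R :> R by rewrite ltr0n.
(* The means sum to [m], so the exponential factors multiply to [expR (- m%:R)]. *)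
have prodE : \prod_(i < n) poisson_lt k (m%:R * p i) =
             expR (- m%:R) * (capped_poly p (fun=> k)).[m%:R].
  rewrite horner_capped_poly /poisson_lt big_split /=; congr (_ * _).
  by rewrite -expR_sum sumrN -mulr_sumr p1 mulr1.
rewrite /Pr_balls (eq_bigl (fun f : {ffun 'I_m -> 'I_n} =>
    [forall i, (load f i < (fun=> k) i)%N])); last by move=> f; rewrite maxload_lt.
rewrite sum_capped_loads prodE.
have := coef_mul_exp_le_horner m (ltW M0) (capped_poly_coef_ge0 (fun=> k) p0).
set q := _`_m; set Q := _.[_] => qQ.
rewrite -(ler_pM2r (exprn_gt0 m M0)) -[leLHS]mulrA.
apply: (le_trans (ler_wpM2l (ler0n _ _) qQ)).
have := ler_wpM2l (expR_ge0 (- m%:R)) (fact_mul_expR_le m0).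
rewrite mulrCA [expR (- _) * expR _]mulrC expRxMexpNx_1 mulr1 => hm.
have Q0 : 0 <= Q.
  apply: le_trans qQ; rewrite mulr_ge0 ?exprn_ge0 //.
  exact: capped_poly_coef_ge0.
apply: (le_trans (ler_wpM2r Q0 hm)).
by rewrite le_eqVlt; apply/orP; left; apply/eqP; ring.
Qed.
End Poissonization.

(** * The threshold for the maximum load *)

Section MaxLoad.
Variable R : realType.

Lemma fact_leq_exp k : (k`! <= k ^ k)%N.
Proof.
elim: k => // k IHk; rewrite factS expnS leq_mul2l /=.
by apply: (leq_trans IHk); case: k {IHk} => // k; rewrite leq_exp2r.
Qed.

Lemma Pr_maxload_lt_pigeonhole m n k (p : 'I_n -> R) : (0 < n)%N -> (n * k <= m)%N ->
  Pr_balls p (fun f : {ffun 'I_m -> 'I_n} => (maxload f < k)%N) = 0.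
Proof.
move=> n0 nkm; rewrite /Pr_balls big_pred0 // => f; apply/negbTE.
rewrite -leqNgt -(leq_pmul2l n0); exact: leq_trans (leq_balls_maxload f).
Qed.

Lemma Pr_maxload_lt_bound m n k (p : 'I_n -> R) (L mu : R) : prob_vec p ->
  (0 < n)%N -> (0 < m)%N -> (0 < k)%N -> n%:R = expR L -> k%:R <= L ->
  0 <= mu <= 1 -> 2 * n%:R * mu <= m%:R ->
  3 * L <= expR (-1) * (mu / k%:R) ^+ k * (m%:R / (16 * L)) ->
  Pr_balls p (fun f : {ffun 'I_m -> 'I_n} => (maxload f < k)%N) <= expR 1 / n%:R.
Proof.
move=> pp n0 m0 k0 nE kL /andP[mu0 mu1] nmu main.
have [nkm|mnk] := leqP (n * k) m.
  by rewrite Pr_maxload_lt_pigeonhole // divr_ge0 ?expR_ge0.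
have K0 : 0 < k%:R :> R by rewrite ltr0n.
have L0 : 0 < L by exact: lt_le_trans kL.
(* Here [m < n * k] and [k <= L <= expR L = n], so [m] is at most the square of [n]. *)
have mle : m%:R <= expR (2 * L).
  apply: (@le_trans _ _ (n%:R * k%:R)); first by rewrite -natrM ler_nat ltnW.
  rewrite [2 * L]mulr_natl mulr2n expRD nE ler_wpM2l ?expR_ge0 //.
  by apply: (le_trans kL); apply: le_trans (expR_ge1Dx L); rewrite lerDr.
have [p0 p1] := pp.
suff H : \prod_(i < n) poisson_lt k (m%:R * p i) <= expR (- (3 * L)).
  apply: (le_trans (Pr_maxload_lt pp m0 k0)); rewrite -mulrA.
  rewrite ler_wpM2l ?expR_ge0 //.
  apply: (@le_trans _ _ (expR (2 * L) * expR (- (3 * L)))).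
    apply: ler_pM => //; apply: prodr_ge0 => i _.
    by rewrite poisson_lt_ge0 // mulr_ge0.
  by rewrite -expRD nE -expRN ler_expR; lra.
have lam0 i : 0 <= m%:R * p i by rewrite mulr_ge0.
have [H|H] := prod_poisson_lt k L0 mu0 lam0; apply: (le_trans H).
  (* [2 <= e] and [k <= L] turn [2 ^+ k] into at most [expR L]. *)
  apply: (@le_trans _ _ (expR k%:R * expR (- (4 * L)))).
    rewrite ler_wpM2r ?expR_ge0 // -[k%:R]mul1r expRM_natr.
    by rewrite lerXn2r ?nnegrE ?expR_ge0 //; have := expR_ge1Dx (1 : R); lra.
  by rewrite -expRD ler_expR; lra.
rewrite ler_expR lerN2 -mulr_sumr p1 mulr1; apply: (le_trans main).
have kf0 : 0 < k`!%:R :> R by rewrite ltr0n fact_gt0.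
apply: ler_pM.
- by rewrite mulr_ge0 ?expR_ge0 // exprn_ge0 // divr_ge0.
- by rewrite divr_ge0 // mulr_ge0 // ltW.
- apply: ler_pM; rewrite ?expR_ge0 ?exprn_ge0 ?divr_ge0 //.
    by rewrite ler_expR lerN2.
  rewrite expr_div_n ler_wpM2l ?exprn_ge0 // lef_pV2 ?posrE ?exprn_gt0 //.
  by rewrite -natrX ler_nat fact_leq_exp.
(* From [2 * n * mu <= m], at least half of the total mean [m] survives the subtraction of [n * mu];
   hence 16 in place of 8. *)
- have -> : m%:R / (16 * L) = m%:R / 2 / (8 * L) by field; rewrite gt_eqF.
  rewrite ler_wpM2r ?invr_ge0 ?mulr_ge0 ?(ltW L0) //.
  by lra.
Qed.

Lemma exprn_le_expR D (x : R) : 0 <= x -> x ^+ D / D`!%:R <= expR x.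
Proof.
move=> x0; apply: (le_trans _ (texp_le_expR D.+1 x0)).
by rewrite /texp big_ord_recr /= lerDr -/(texp D x) texp_ge0.
Qed.

(* With L = ln n and k about L / (2 (C + 2) ln L), the factor (mu / k) ^ k is
   at least L ^ (- (C + 2) k), that is, about n ^ (- 1/2). *)
Lemma threshold_bound (c : R) (C : nat) : 0 < c -> c <= 1 ->
  exists L0 : R, forall L M : R, L0 <= L -> c * expR L / L ^+ C <= M ->
    let k := (Num.trunc ((2 * C.+2%:R)^-1 * L / ln L)).+1 in
    let mu := c / (2 * L ^+ C) in
    [/\ 0 < L, k%:R <= L, 0 <= mu <= 1 &
        3 * L <= expR (-1) * (mu / k%:R) ^+ k * (M / (16 * L))].
Proof.
(* The final estimate loses [2 * C + 3] powers of [L]; two more provide the factor [L] of the target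
   and one to absorb [A]. *)
move=> c0 c1; pose D := (2 * C + 5)%N.
pose A : R := 48 * expR 1 * (2 ^+ D * D`!%:R) / c.
(* The summands ensure [1 <= ln L], [2 <= c * L] and [A <= L] respectively. *)
exists (expR 1 + 2 / c + A) => L M LL0 HM k mu.
have D0 : 0 < 2 ^+ D * D`!%:R :> R by rewrite mulr_gt0 ?exprn_gt0 ?ltr0n ?fact_gt0.
have A0 : 0 < A by rewrite divr_gt0 // !mulr_gt0 ?expR_gt0.
have c20 : 0 <= 2 / c by rewrite divr_ge0 // ltW.
have e2 : 2 <= expR 1 :> R by have := expR_ge1Dx (1 : R); lra.
have eL : expR 1 <= L by lra.
have cL : 2 / c <= L by lra.
have AL : A <= L by lra.
have L2 : 2 <= L by lra.
have L0 : 0 < L by lra.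
have Ln0 j : 0 < L ^+ j by rewrite exprn_gt0.
have l1 : 1 <= ln L by rewrite -[leLHS]expRK ler_ln ?posrE ?expR_gt0.
have l0 : 0 < ln L by lra.
have C2 : 0 < 2 * C.+2%:R :> R by rewrite mulr_gt0.
set t := (2 * C.+2%:R)^-1 * L / ln L in k *.
have tl : C.+2%:R * (ln L * t) = L / 2.
  by rewrite /t; field; rewrite ?pnatr_eq0 ?gt_eqF //.
have t0 : 0 <= t by rewrite /t !mulr_ge0 ?invr_ge0 ?ltW.
have kt : k%:R <= t + 1 by rewrite /k -natr1 lerD2r truncn_le.
have t4 : t <= L / 4.
  have : 2 * t <= C.+2%:R * (ln L * t).
    apply: ler_pM => //; first by rewrite (ler_nat R 2).
    by rewrite -[leLHS]mul1r ler_wpM2r.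
  by rewrite tl; lra.
have kL : k%:R <= L by lra.
have K0 : 0 < k%:R :> R by rewrite ltr0n.
have mu0 : 0 < mu by rewrite divr_gt0 // mulr_gt0.
split => //.
  rewrite ltW //= ler_pdivrMr ?mulr_gt0 // mul1r.
  have : 1 <= L ^+ C by rewrite exprn_ege1 //; lra.
  by lra.
(* The two extra powers of [L] absorb [k <= L] and [2 <= c * L]. *)
have muk : (L ^+ C.+2)^-1 <= mu / k%:R.
  rewrite /mu -mulrA -invfM ler_pdivlMr ?mulr_gt0 // [leLHS]mulrC ler_pdivrMr //.
  rewrite exprSr exprSr.
  move: cL; rewrite ler_pdivrMr // => cL.
  have -> : c * (L ^+ C * L * L) = L ^+ C * (L * c * L) by ring.
  have -> : 2 * L ^+ C * k%:R = L ^+ C * (2 * k%:R) by ring.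
  rewrite ler_pM2l //; apply: ler_pM => //; lra.
(* The exponent [t] alone would give exactly [expR (- (L / 2))]; the division by [L ^+ C.+2] pays
   for [k <= t + 1]. *)
have pw : expR (- (L / 2)) / L ^+ C.+2 <= (mu / k%:R) ^+ k.
  apply: (@le_trans _ _ ((L ^+ C.+2)^-1 ^+ k)); last first.
    have mk0 : 0 <= mu / k%:R by rewrite divr_ge0 // ltW.
    by apply: lerXn2r => //; rewrite nnegrE // invr_ge0 ltW.
  have -> : (L ^+ C.+2)^-1 = expR (- (ln L * C.+2%:R)) by rewrite expRN expRM_natr lnK.
  rewrite -expRM_natr -expRD ler_expR -tl.
  have := ler_wpM2l (mulr_ge0 (ltW l0) (ler0n R C.+2)) kt.
  by lra.
apply: (@le_trans _ _ (expR (-1) * (expR (- (L / 2)) / L ^+ C.+2) *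
                        (c * expR L / L ^+ C / (16 * L)))); last first.
  apply: ler_pM.
  - by rewrite mulr_ge0 ?expR_ge0 // divr_ge0 ?expR_ge0 ?ltW.
  - by rewrite !divr_ge0 ?mulr_ge0 ?expR_ge0 ?ltW.
  - by rewrite ler_wpM2l ?expR_ge0.
  - by rewrite ler_wpM2r // invr_ge0 mulr_ge0 ?ltW.
have expL : expR (- (L / 2)) * expR L = expR (L / 2) by rewrite -expRD; congr expR; lra.
have eD := exprn_le_expR D (divr_ge0 (ltW L0) (ler0n R 2)).
have -> : expR (-1) * (expR (- (L / 2)) / L ^+ C.+2) * (c * expR L / L ^+ C / (16 * L)) =
    (expR (- (L / 2)) * expR L) * (c / (16 * (expR 1 * L ^+ (2 * C + 3)))).
  have -> : L ^+ (2 * C + 3) = L ^+ C * L ^+ C * (L * L * L).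
    by rewrite mul2n -addnn !exprD; ring.
  rewrite (expRN 1) [L ^+ C.+2]exprS [L ^+ C.+1]exprS.
  have := Ln0 C; have := expR_gt0 (1 : R).
  move: (L ^+ C) (expR 1) (expR L) (expR (- (L / 2))) => X e u v e0 X0.
  field.
  by rewrite !gt_eqF.
rewrite expL; apply: (@le_trans _ _ ((L / 2) ^+ D / D`!%:R *
    (c / (16 * (expR 1 * L ^+ (2 * C + 3)))))); last first.
  by rewrite ler_wpM2r // divr_ge0 ?mulr_ge0 ?expR_ge0 ?ltW.
have -> : (L / 2) ^+ D / D`!%:R * (c / (16 * (expR 1 * L ^+ (2 * C + 3)))) =
    3 * L * (L / A).
  have LD : L ^+ D = L ^+ (2 * C + 3) * (L * L).
    by rewrite /D -[5%N]/(3 + 2)%N addnA exprD.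
  have F0 : 0 < D`!%:R :> R by rewrite ltr0n fact_gt0.
  have P0 : 0 < 2 ^+ D :> R by rewrite exprn_gt0.
  have := Ln0 (2 * C + 3)%N; have := expR_gt0 (1 : R).
  move: F0 P0; rewrite /A expr_div_n LD.
  move: (L ^+ (2 * C + 3)) (expR 1) (2 ^+ D) (D`!%:R) => X e u v v0 u0 e0 X0.
  by field; rewrite !gt_eqF.
rewrite -[leLHS]mulr1 ler_wpM2l ?mulr_ge0 ?(ltW L0) //.
by rewrite ler_pdivlMr // mul1r.
Qed.

End MaxLoad.

Theorem mainTheorem20 (R : realType) (m : nat -> nat)
  (p : forall n : nat, 'I_n -> R)
  (hp : forall n : nat, (0 < n)%N -> prob_vec (p n))
  (hm : exists (c : R) (C : nat) (N : nat), 0 < c /\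
          forall n : nat, (N <= n)%N ->
            c * n%:R / (ln (n%:R : R)) ^+ C <= (m n)%:R) :
  exists c' : R, 0 < c' /\
    (fun n : nat => Pr_balls (p n)
        (fun f : {ffun 'I_(m n) -> 'I_n} =>
           c' * ln (n%:R : R) / ln (ln (n%:R : R)) <= (maxload f)%:R))
      @ \oo --> (1 : R).
Proof.
case: hm => c0 [C [N [c0_gt0 hm]]].
(* Capping the constant at 1 gives [mu <= 1] later. *)
pose c := Num.min c0 1.
have c_gt0 : 0 < c by rewrite lt_min c0_gt0 ltr01.
have c_le1 : c <= 1 by rewrite ge_min lexx orbT.
have [L0 HL0] := threshold_bound C c_gt0 c_le1.
exists (2 * C.+2%:R)^-1; split; first by rewrite invr_gt0 mulr_gt0.
apply/cvgrPdist_le => eps eps0.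
(* The last two bounds yield [L0 <= ln n] and [expR 1 / n <= eps]. *)
exists (maxn N (maxn (Num.trunc (expR L0)).+1 (Num.trunc (expR 1 / eps)).+1)) => // n /=.
rewrite !geq_max => /and3P[Nn L0n epsn].
have n0 : (0 < n)%N by exact: leq_ltn_trans L0n.
have nR0 : 0 < n%:R :> R by rewrite ltr0n.
have nE : n%:R = expR (ln n%:R) :> R by rewrite lnK.
have LL0 : L0 <= ln n%:R :> R.
  rewrite -ler_expR -nE ltW //; apply: lt_le_trans (truncnS_gt _) _.
  by rewrite ler_nat.
have mn : c * n%:R / ln (n%:R : R) ^+ C <= (m n)%:R.
  apply: le_trans (hm n Nn).
  have ln0 : 0 <= ln (n%:R : R) by rewrite ln_ge0 // ler1n.
  by rewrite -!mulrA ler_wpM2r ?divr_ge0 ?exprn_ge0 // ge_min lexx.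
have := HL0 (ln n%:R) (m n)%:R LL0; rewrite -nE => /(_ mn) /=.
set t := (2 * C.+2%:R)^-1 * ln n%:R / ln (ln n%:R); set k := (Num.trunc t).+1.
set mu := c / _ => -[L_gt0 kL mu01 main].
have m0 : (0 < m n)%N.
  by rewrite -(ltr0n R) (lt_le_trans _ mn) // divr_gt0 ?mulr_gt0 ?exprn_gt0.
have nmu : 2 * n%:R * mu <= (m n)%:R.
  apply: le_trans mn; rewrite /mu le_eqVlt; apply/orP; left; apply/eqP.
  by field; rewrite gt_eqF ?exprn_gt0.
rewrite (Pr_ballsC _ (hp n n0)) subKr ger0_norm ?Pr_balls_ge0 //; last exact: hp.
apply: (@le_trans _ _ (expR 1 / n%:R)); last first.
  rewrite ler_pdivrMr // mulrC -ler_pdivrMr // ltW //.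
  by apply: lt_le_trans (truncnS_gt _) _; rewrite ler_nat.
apply: le_trans (Pr_maxload_lt_bound (hp n n0) n0 m0 (ltn0Sn _) nE kL mu01 nmu main).
apply: le_Pr_balls; first exact: hp.
(* A maximum load below the real threshold [t] is below the integer [k], because [t < k]. *)
move=> f; rewrite !unfold_in /= -ltNge => ft.
by rewrite -(ltr_nat R) (lt_trans ft) // truncnS_gt.
Qed.
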